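(* Let $W$ be a finite nonempty multiset of positive real numbers and let $\mathcal{T}_W$ be the set of all weighted trees $T$ whose multiset of edge weights $\{\omega(e): e\in E(T)\}$ equals $W$. Then every element of $\mathcal{T}_W$ maximizing the Kemeny's constant $\kappa$ is a weighted path, and the weighted star $S_W$ is the unique element of $\mathcal{T}_W$ (up to weighted isomorphism) minimizing $\kappa$.
   Context: A weighted graph $G=(V,E)$ has positive edge weights $\omega(e)$; the random walk on $G$ moves from $u$ to a neighbor $v$ with probability proportional to $\omega(uv)$. The hitting time $H_G(u,v)$ is the expected number of steps for the walk started at $u$ to first reach $v$ ($H_G(v,v)=0$). With $\pi_G$ the stationary distribution of this walk, the Kemeny's constant is $\kappa(G)=\sum_{v\in V}H_G(u,v)\pi_G(v)$, which does not depend on the choice of $u$. $S_W$ denotes the unique element of $\mathcal{T}_W$ whose underlying graph is a star. *)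

(* Defs.v *)
From HB Require Import structures.
From mathcomp Require Import all_boot all_order all_algebra.
From mathcomp Require Import finmap multiset.
From mathcomp Require Import all_classical all_reals all_analysis.

Set Implicit Arguments.
Unset Strict Implicit.
Unset Printing Implicit Defensive.

Import Order.TTheory GRing.Theory Num.Theory.

Local Open Scope ring_scope.
Local Open Scope mset_scope.

(* Finite simple graphs: an edge is a two-element set of vertices.  The values
   of [weight] outside [edges] are irrelevant and never used below. *)
Record wgraph (R : realType) := WGraph {
  vertex : finType;
  edges : {set {set vertex}};
  weight : {set vertex} -> R;
  edges_card : forall e, e \in edges -> #|e| = 2%N;
  weight_gt0 : forall e, e \in edges -> 0 < weight e
}.

Section Graph.
Variables (R : realType) (G : wgraph R).
Implicit Types u v : vertex G.

Definition adj : rel (vertex G) :=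
  fun u v => [set u; v]%SET \in edges G.

Definition is_connected : Prop :=
  (0 < #|vertex G|)%N /\ forall u v, connect adj u v.

Definition is_acyclic : Prop :=
  forall c : seq (vertex G), ucycle adj c -> (size c <= 2)%N.

Definition is_tree : Prop := is_connected /\ is_acyclic.

Definition is_path : Prop :=
  exists (n : nat) (f : 'I_n -> vertex G), bijective f /\
    forall i j : 'I_n, adj (f i) (f j) = (i.+1 == j :> nat) || (j.+1 == i :> nat).

Definition is_star : Prop :=
  exists c, forall u v, adj u v = (u != v) && ((u == c) || (v == c)).

Definition edge_weights : {mset R} :=
  seq_mset [seq weight e | e <- enum (edges G)].

Definition trans u v : R :=
  if adj u v
  then weight [set u; v]%SET / \sum_(w | adj u w) weight [set u; w]%SET
  else 0.

(* Probability that the walk started at [u] begins with the steps [s]. *)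
Fixpoint walk_prob u (s : seq (vertex G)) : R :=
  if s is v :: s' then trans u v * walk_prob v s' else 1.

(* Probability that the walk started at [u] is at [v] for the first time at
   time [n]; the trajectory is [u] followed by the [n] steps [s], and
   [belast u s] is that trajectory without its final position. *)
Definition first_hit_prob (n : nat) u v : R :=
  \sum_(s : n.-tuple (vertex G) | (last u s == v) && (v \notin belast u s))
     walk_prob u s.

(* Expectation of the first time at which the walk is at [v], as a random
   variable with values in N u {+oo}; the second summand is the contribution
   of never reaching [v], with the convention +oo * 0 = 0. *)
Definition hitting_time u v : \bar R :=
  (\sum_(0 <= n <oo) (n%:R * first_hit_prob n u v)%:E
   + +oo * (1 - \sum_(0 <= n <oo) (first_hit_prob n u v)%:E))%E.

Definition stationary (p : vertex G -> R) : Prop :=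
  [/\ forall v, 0 <= p v, \sum_v p v = 1
    & forall v, \sum_u p u * trans u v = p v].

Definition stationary_dist : vertex G -> R :=
  xget (fun=> 0) [set p | stationary p]%classic.

Definition kemeny_from u : \bar R :=
  (\sum_v hitting_time u v * (stationary_dist v)%:E)%E.

(* On a connected graph [kemeny_from u] does not depend on [u], so the
   starting vertex may be picked arbitrarily. *)
Definition kemeny : \bar R :=
  if [pick u : vertex G] is Some u then kemeny_from u else 0%E.

End Graph.

Definition weighted_iso (R : realType) (G H : wgraph R) : Prop :=
  exists f : vertex G -> vertex H, [/\ bijective f,
    forall u v, adj (f u) (f v) = adj u v
    & forall u v, adj u v ->
        weight [set f u; f v]%SET = weight [set u; v]%SET].

Definition in_TW (R : realType) (W : {mset R}) (T : wgraph R) : Prop :=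
  is_tree T /\ edge_weights T = W.

Definition maximizes_kemeny (R : realType) (W : {mset R}) (T : wgraph R) :
    Prop :=
  in_TW W T /\ forall T', in_TW W T' -> (kemeny T' <= kemeny T)%E.

Definition minimizes_kemeny (R : realType) (W : {mset R}) (T : wgraph R) :
    Prop :=
  in_TW W T /\ forall T', in_TW W T' -> (kemeny T <= kemeny T')%E.

Lemma adj_irr (R : realType) (G : wgraph R) : irreflexive (@adj R G).
Proof.
by move=> u; apply/negP => /edges_card; rewrite finset.setUid cards1.
Qed.

Lemma adj_sym (R : realType) (G : wgraph R) : symmetric (@adj R G).
Proof. by move=> u v; rewrite /adj finset.setUC. Qed.

Lemma weighted_iso_sym (R : realType) (G H : wgraph R) :
  weighted_iso G H -> weighted_iso H G.
Proof.
move=> [f [[g fK gK] fadj fw]]; exists g; split; first by exists f.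
  by move=> u v; rewrite -fadj !gK.
by move=> u v uv; rewrite -fw ?gK // -fadj !gK.
Qed.

Section Star.
Variables (R : realType) (W : {mset R}).
Hypothesis W_gt0 : forall x, x \in W -> 0 < x.

Let n := size (enum_mset W).

Definition star_edges : {set {set option 'I_n}} :=
  [set [set None; Some i]%SET | i : 'I_n]%SET.

(* On the edge {None, Some i} the sum has the single term of index i. *)
Definition star_weight (e : {set option 'I_n}) : R :=
  \sum_(i < n | Some i \in e) nth 0 (enum_mset W) i.

Lemma star_weightE i :
  star_weight [set None; Some i]%SET = nth 0 (enum_mset W) i.
Proof.
by rewrite /star_weight (big_pred1 i) // => j; rewrite !inE.
Qed.

Lemma star_edges_card e : e \in star_edges -> #|e| = 2%N.
Proof. by case/imsetP => i _ ->; rewrite cards2. Qed.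

Lemma star_weight_gt0 e : e \in star_edges -> 0 < star_weight e.
Proof.
case/imsetP => i _ ->; rewrite star_weightE; apply: W_gt0.
exact: mem_nth.
Qed.

(* The weighted star S_W: centre [None], one leaf per element of W. *)
Definition star_graph : wgraph R := WGraph star_edges_card star_weight_gt0.

Lemma star_adj (u v : vertex star_graph) :
  adj u v = (u != v) && ((u == None) || (v == None)).
Proof.
apply/imsetP/idP => [[i _ /setP e] | ].
  have := e u; have := e v; have := e None; have := e (Some i).
  rewrite !inE; case: u {e} => [j|]; case: v => [k|] //=.
  by rewrite eqxx.
case: u => [j|]; case: v => [k|] //=; first by rewrite andbF.
  by exists j => //; rewrite finset.setUC.
by exists k.
Qed.

Lemma star_graph_star : is_star star_graph.
Proof. by exists None => u v; rewrite star_adj. Qed.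

Lemma star_graph_TW : in_TW W star_graph.
Proof.
split; last first.
  have injE : injective (fun i : 'I_n => [set None; Some i]%SET).
    by move=> i j /setP /(_ (Some i)); rewrite !inE eqxx /= => /esym/eqP[].
  rewrite -[RHS]seq_mset_id; apply/eq_seq_msetP.
  have pE : perm_eq (enum star_edges)
                    [seq [set None; Some i]%SET | i <- enum 'I_n].
    apply: uniq_perm; rewrite ?(map_inj_uniq injE) ?enum_uniq //.
    move=> e; rewrite mem_enum.
    apply/imsetP/mapP => -[i _ ->]; exists i => //.
    by rewrite mem_enum.
  apply: (perm_trans (perm_map star_weight pE)).
  rewrite -map_comp (eq_map (g := fun i : 'I_n => nth 0 (enum_mset W) i)).
    rewrite (map_comp (nth 0 (enum_mset W)) val) val_enum_ord.
    by rewrite -/(mkseq _ _) mkseq_nth.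
  by move=> i /=; rewrite star_weightE.
split.
  split; first by rewrite card_option.
  have c0 (v : vertex star_graph) : connect (@adj _ star_graph) None v.
    case: v => [i|]; last exact: connect0.
    by apply: connect1; rewrite star_adj.
  move=> u v; apply: connect_trans (c0 v).
  by rewrite (sym_connect_sym (@adj_sym _ star_graph)).
have nSS i j : adj (Some i : vertex star_graph) (Some j) = false.
  by rewrite star_adj andbF.
case=> [|x [|y [|z s]]] //; rewrite /ucycle => /andP[/= /and3P[xy yz zs] Uc].
exfalso; case: y xy yz Uc => [j|] xy yz.
  case: x xy zs => [i|] xy zs; first by rewrite nSS in xy.
  case: z yz zs => [k|] yz zs; first by rewrite nSS in yz.
  by rewrite !inE /=.
case: x xy zs => [i|] xy zs; last by rewrite adj_irr in xy.
case: z yz zs => [k|] yz; last by rewrite adj_irr in yz.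
case: s => [|[l|] s] /=; rewrite ?nSS //.
by rewrite !inE /= andbF.
Qed.

Lemma star_graph_unique (T : wgraph R) :
  in_TW W T -> is_star T -> weighted_iso T star_graph.
Proof.
move=> [_ TW] [c cP]; apply: weighted_iso_sym.
pose L := enum [set~ c]%SET.
have UL : uniq L by exact: enum_uniq.
have memL v : (v \in L) = (v != c) by rewrite mem_enum !inE.
have pE : perm_eq (enum (edges T)) [seq [set c; v]%SET | v <- L].
  apply: uniq_perm; rewrite ?enum_uniq //.
    rewrite map_inj_in_uniq // => u v; rewrite !memL => uc vc /setP /(_ u).
    by rewrite !inE eqxx orbT (negPf uc) /= => /esym/eqP.
  move=> e; rewrite mem_enum; apply/idP/mapP => [eE | [v vL ->]].
    have /eqP/cards2P[u [v [uv E]]] := edges_card eE.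
    have := cP u v; rewrite /adj -E eE uv /= => /esym/orP[] /eqP ec.
      by exists v; rewrite ?memL -?ec // eq_sym.
    by exists u; rewrite ?memL -?ec // E finset.setUC.
  by have := cP c v; rewrite /adj eqxx /= andbT eq_sym => ->; rewrite -memL.
pose ws := [seq weight [set c; v]%SET | v <- L].
have pW : perm_eq (enum_mset W) ws.
  have /eq_seq_msetP pT : edge_weights T = seq_mset (enum_mset W).
    by rewrite seq_mset_id.
  rewrite perm_sym; apply: perm_trans pT; rewrite perm_sym.
  by apply: (perm_trans (perm_map _ pE)); rewrite -map_comp.
have [Is pI WE] := perm_iotaP 0 pW.
have szI : size Is = n by rewrite /n WE size_map.
have szL : size L = n by rewrite /n (perm_size pW) size_map.
have UI : uniq Is by rewrite (perm_uniq pI) iota_uniq.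
have ltI (i : 'I_n) : (nth 0%N Is i < size L)%N.
  have : nth 0%N Is i \in Is by rewrite mem_nth // szI.
  by rewrite (perm_mem pI) mem_iota size_map.
pose f (x : vertex star_graph) : vertex T :=
  if x is Some i then nth c L (nth 0%N Is i) else c.
have fS i : f (Some i) != c by rewrite -memL mem_nth.
have f_inj : injective f.
  move=> [i|] [j|] // => [/eqP | E | E].
  - by rewrite nth_uniq // nth_uniq ?szI // => /eqP/val_inj ->.
  - by have := fS i; rewrite E eqxx.
  - by have := fS j; rewrite -E eqxx.
have fN x : (f x == c) = (x == None).
  by case: x => [i|]; rewrite ?eqxx //; exact/negbTE/fS.
have wE (i : 'I_n) : weight [set c; f (Some i)]%SET =
                     star_weight [set None; Some i]%SET.
  rewrite star_weightE [in RHS]WE (nth_map 0%N) ?szI //.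
  by rewrite (nth_map c).
exists f; split.
- apply: inj_card_bij => //; rewrite card_option card_ord -szL -cardE.
  by rewrite cardsC1; case: #|_| (fintype0 (T := vertex T) c) => //.
- by move=> u v; rewrite cP star_adj (inj_eq f_inj) !fN.
- move=> [i|] [j|]; rewrite star_adj ?andbF //= => _; last exact: wE.
  by rewrite !(finset.setUC _ [set None]%SET) !(finset.setUC _ [set c]%SET); exact: wE.
Qed.

End Star.

(* Main.v *)
Require Import Defs.
From mathcomp Require Import all_boot all_order all_algebra.
From mathcomp Require Import finmap multiset.
From mathcomp Require Import all_classical all_reals all_analysis.
From mathcomp Require Import ring lra zify.

(* Removing an edge e from a tree splits the total degree t into s and t - s,
   and the Kemeny constant is the sum over e of s (t - s) / w(e), divided by t.
   Both parts are at least w(e), so s (t - s) >= w(e) (t - w(e)), with equality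
   exactly when e is a leaf edge: summing gives a bound depending only on W,
   attained exactly by the star.  If a vertex v has three neighbours x, y, z
   and the branch at y is not heavier than the branch at z, then replacing the
   edge vx by yx only changes the term of the edge vy, which strictly
   increases: a maximizer has no vertex of degree at least 3. *)

Set Implicit Arguments.
Unset Strict Implicit.
Unset Printing Implicit Defensive.

Import Order.TTheory GRing.Theory Num.Theory numFieldNormedType.Exports.

Local Open Scope ring_scope.
Local Open Scope mset_scope.

(** * Hitting times from the first-step equations *)

(** [hitting_time] is defined by extended-real series and [stationary_dist] by choice, so neither
    can be computed directly. On a finite chain, a nonnegative real solution of the first-step
    equations forces the target to be hit almost surely with geometric tails, and is then the
    expected hitting time; on a tree such a solution can be written down. Crossing an edge e = ab
    from a to b takes s / w(e) steps on average, where s is the degree sum of the side of a, and a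
    walk from u to v has to cross in turn every edge separating them. Averaging over v with weight
    deg v / t, the edge e receives s / w(e) times (t - s) / t, whence the formula. *)

Lemma cvg_natM_geometric_bound (R : realType) (r : nat -> R) (y : R) :
  0 < y < 1 -> (forall n, 0 <= r n) -> (forall n, r n.+1 <= y ^+ 2 * r n) ->
  (n%:R * r n @[n --> \oo] --> (0 : R))%classic.
Proof.
move=> /andP[y0 y1] r0 rS.
(* The ratio is a square so that the bound carries two factors y^n: one absorbs n, since n y^n is at
   most a partial sum of the geometric series, and the other tends to 0. *)
have rle n : r n <= (y ^+ n) ^+ 2 * r 0%N.
  elim: n => [|n IH]; first by rewrite !expr0 expr1n mul1r.
  apply: (le_trans (rS n)); rewrite (exprS y n) exprMn -[leRHS]mulrA.
  by rewrite ler_wpM2l // sqr_ge0.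
have ny n : n%:R * y ^+ n <= 1 / (1 - y).
  apply: (le_trans _ (@geometric_le_lim R n 1 y ler01 y0 _)); last first.
    by rewrite gtr0_norm.
  rewrite /series /= mulrC mulr_natr -[X in _ *+ X]subn0 -sumr_const_nat.
  apply: ler_sum_nat => i /andP[_ ltin]; rewrite mul1r.
  by rewrite ler_wiXn2l ?(ltW y0) ?(ltW y1) ?(ltnW ltin).
apply: (@squeeze_cvgr _ _ _ _ (fun=> 0) (geometric (1 / (1 - y) * r 0%N) y)).
- near=> n; rewrite mulr_ge0 //=.
  apply: (@le_trans _ _ (n%:R * ((y ^+ n) ^+ 2 * r 0%N))).
    by rewrite ler_wpM2l.
  have -> : n%:R * ((y ^+ n) ^+ 2 * r 0%N) = n%:R * y ^+ n * (r 0%N * y ^+ n).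
    by set z := y ^+ n; ring.
  rewrite /geometric /= -[leRHS]mulrA ler_wpM2r //.
  by rewrite mulr_ge0 // exprn_ge0 // ltW.
- exact: cvg_cst.
- by apply: cvg_geometric; rewrite gtr0_norm.
Unshelve. all: by end_near. Qed.

Section Hitting.
Variables (R : realType) (G : wgraph R) (v : vertex G).
Implicit Types u w : vertex G.

Lemma first_hit_prob0 u : first_hit_prob 0 u v = (u == v)%:R.
Proof.
rewrite /first_hit_prob; have [uv|uv] := boolP (u == v).
  rewrite (big_pred1 [tuple]) // => s.
  by rewrite tuple0 /= uv /= eqxx.
by rewrite big_pred0 // => s; rewrite tuple0 /= (negbTE uv).
Qed.

(** The factor [u != v] kills the walk at its target: a trajectory starting at [v] has hit it at
    time 0. *)
Lemma first_hit_probS n u :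
  first_hit_prob n.+1 u v =
  (u != v)%:R * \sum_w trans u w * first_hit_prob n w v.
Proof.
rewrite /first_hit_prob.
rewrite (reindex (fun p : vertex G * n.-tuple (vertex G) => [tuple of p.1 :: p.2])) /=; last first.
  exists (fun t => (thead t, [tuple of behead t])) => [[w t] _ | t _] /=.
    by rewrite theadE; congr pair; apply: val_inj.
  by rewrite -tuple_eta.
transitivity (\sum_(p : vertex G * n.-tuple (vertex G) |
    (last p.1 p.2 == v) && (v \notin belast p.1 p.2))
    (u != v)%:R * (trans u p.1 * walk_prob p.1 p.2)).
  rewrite big_mkcond [RHS]big_mkcond; apply: eq_bigr => -[w t] _ /=.
  rewrite inE negb_or [v == u]eq_sym.
  by case: (u != v); rewrite ?mul1r ?mul0r //= andbF if_same.
rewrite -mulr_sumr; congr (_ * _).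
by under eq_bigr do rewrite mulr_sumr; rewrite pair_big_dep /=.
Qed.

Variable h : vertex G -> R.
Hypothesis trans_ge0 : forall u w, 0 <= trans u w.
Hypothesis trans_sum1 : forall u, \sum_w trans u w = 1.
Hypothesis h_ge0 : forall u, 0 <= h u.
Hypothesis hv : h v = 0.
Hypothesis hE : forall u, u != v -> h u = 1 + \sum_w trans u w * h w.

(** [s n u] is the probability that [v] is not hit by time n. [r n u] will be the expected time
    still to run after time n. Both follow the recursion of the walk killed at [v]. [C] bounds [h]
    and is at least 1. *)
Let s n u : R := 1 - \sum_(k < n.+1) first_hit_prob k u v.
Let r n u : R := h u - \sum_(k < n) s k u.
Let C : R := 1 + \sum_u h u.

Let s0 u : s 0%N u = (u != v)%:R.
Proof.
rewrite /s big_ord_recl big_ord0 first_hit_prob0 addr0.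
by case: (u == v); rewrite ?subrr ?subr0.
Qed.

Let sS n u : s n.+1 u = (u != v)%:R * \sum_w trans u w * s n w.
Proof.
rewrite /s big_ord_recl first_hit_prob0.
under eq_bigr do rewrite first_hit_probS.
rewrite -mulr_sumr exchange_big /=.
under eq_bigr do rewrite -mulr_sumr.
under [in RHS]eq_bigr do rewrite mulrBr mulr1.
rewrite sumrB trans_sum1 mulrBr mulr1.
by case: (u == v) => /=; ring.
Qed.

Let s_ge0 n u : 0 <= s n u.
Proof.
elim: n u => [|n IH] u; first by rewrite s0.
by rewrite sS mulr_ge0 // sumr_ge0 // => w _; rewrite mulr_ge0.
Qed.

Let r0 u : r 0%N u = h u. Proof. by rewrite /r big_ord0 subr0. Qed.

Let rS n u : r n.+1 u = (u != v)%:R * \sum_w trans u w * r n w.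
Proof.
rewrite /r big_ord_recl s0; under eq_bigr do rewrite sS.
rewrite -mulr_sumr exchange_big /=.
under eq_bigr do rewrite -mulr_sumr.
under [in RHS]eq_bigr do rewrite mulrBr.
rewrite sumrB mulrBr.
have [->|uv] := eqVneq u v; first by rewrite hv /=; ring.
by rewrite hE //=; ring.
Qed.

Let r_ge0 n u : 0 <= r n u.
Proof.
elim: n u => [|n IH] u; first by rewrite r0.
by rewrite rS mulr_ge0 // sumr_ge0 // => w _; rewrite mulr_ge0.
Qed.

Let C_ge1 : 1 <= C. Proof. by rewrite lerDl sumr_ge0. Qed.

(** Both sides follow the same killed recursion with nonnegative coefficients, so the comparison at
    time 0 propagates. Together with [rB] it makes [r] decay geometrically. *)
Let r_le n u : r n u <= C * s n u.
Proof.
elim: n u => [|n IH] u.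
  rewrite r0 s0; have [->|uv] := eqVneq u v; first by rewrite hv mulr0.
  rewrite mulr1 /C (bigD1 u) //= addrCA lerDl addr_ge0 // sumr_ge0 //.
rewrite rS sS mulrCA ler_wpM2l // mulr_sumr ler_sum // => w _.
by rewrite mulrCA ler_wpM2l.
Qed.

Let rB n u : r n.+1 u = r n u - s n u.
Proof. by rewrite /r big_ord_recr /=; ring. Qed.

Let s_le n u : s n u <= r n u.
Proof. by have := r_ge0 n.+1 u; rewrite rB subr_ge0. Qed.

Let n_r_cvg u : (n%:R * r n u @[n --> \oo] --> (0 : R))%classic.
Proof.
have C0 : 0 < C by apply: lt_le_trans C_ge1.
(* As [s n u] is at least 2 z times [r n u], one step multiplies [r] by at most 1 - 2 z, hence by at
   most (1 - z)^2, the squared ratio wanted. *)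
pose z := (2 * C)^-1.
have z0 : 0 < z by rewrite invr_gt0 mulr_gt0.
have zC : 2 * z * C = 1 by rewrite /z; field; rewrite gt_eqF.
have z1 : z <= 1 / 2 by have := C_ge1; nra.
apply: (@cvg_natM_geometric_bound _ (r^~ u) (1 - z)) => [|n|n].
- by apply/andP; split; lra.
- exact: r_ge0.
- rewrite rB; have := r_le n u; have := r_ge0 n u; have := s_ge0 n u.
  move=> a b c; have : 2 * z * r n u <= 2 * z * (C * s n u).
    by rewrite ler_wpM2l // mulr_ge0 // ltW.
  rewrite mulrA zC mul1r => d.
  have := mulr_ge0 (sqr_ge0 z) b; rewrite !expr2; nra.
Qed.

Let cvg_n_to0 (a : nat -> R) :
  (forall n, 0 <= a n) -> (n%:R * a n @[n --> \oo] --> (0 : R))%classic ->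
  (a n @[n --> \oo] --> (0 : R))%classic.
Proof.
move=> a0 na; apply: (@squeeze_cvgr _ _ _ _ (fun=> 0) (fun n => n%:R * a n)) => //.
  near=> n; rewrite a0 ler_peMl // ler1n; near: n; exact: nbhs_infty_gt.
exact: cvg_cst.
Unshelve. all: by end_near. Qed.

Let n_s_cvg u : (n%:R * s n u @[n --> \oo] --> (0 : R))%classic.
Proof.
apply: (@squeeze_cvgr _ _ _ _ (fun=> 0) (fun n => n%:R * r n u)) => //.
  by near=> n; rewrite mulr_ge0 // ler_wpM2l.
exact: cvg_cst.
Unshelve. all: by end_near. Qed.

Let f_sum u : (\sum_(0 <= k < n) first_hit_prob k u v @[n --> \oo] --> (1 : R))%classic.
Proof.
rewrite -cvg_shiftS.
under eq_fun do rewrite big_mkord.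
have -> : (fun n => \sum_(k < n.+1) first_hit_prob k u v) = (fun n => 1 - s n u).
  by apply/funext => n; rewrite /s; ring.
have e : (1 - s n u @[n --> \oo] --> (1 - 0 : R))%classic.
  by apply: cvgB; [exact: cvg_cst | exact: cvg_n_to0].
by rewrite subr0 in e.
Qed.

Let nf_sum u :
  (\sum_(0 <= k < n) k%:R * first_hit_prob k u v @[n --> \oo] --> h u)%classic.
Proof.
rewrite -cvg_shiftS.
(* Abel summation: a first-hit probability is a drop of [s], so the sum is that of [s k] for k < n,
   which is h - r n, minus the boundary term n s n. *)
have -> : (fun n => \sum_(0 <= k < n.+1) k%:R * first_hit_prob k u v) =
    (fun n => h u - r n u - n%:R * s n u).
  apply/funext; elim => [|n IH].
    by rewrite big_nat1 r0 !mul0r; ring.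
  rewrite big_nat_recr //= {}IH rB.
  have -> : first_hit_prob n.+1 u v = s n u - s n.+1 u.
    by rewrite {2}/s big_ord_recr /= /s; ring.
  by rewrite -natr1; ring.
have e : (h u - r n u - n%:R * s n u @[n --> \oo] --> (h u - 0 - 0 : R))%classic.
  by apply: cvgB => //; apply: cvgB; [exact: cvg_cst | exact: cvg_n_to0].
by rewrite !subr0 in e.
Qed.

Lemma hitting_timeE u : hitting_time u v = (h u)%:E.
Proof.
rewrite /hitting_time.
(* Total mass 1 turns the second summand of [hitting_time] into +oo * 0 = 0. *)
have -> : (\sum_(0 <= n <oo) (first_hit_prob n u v)%:E = 1%:E)%E.
  apply/cvg_lim => //; under eq_fun do rewrite sumEFin.
  by apply: cvg_EFin => //; [near=> n | exact: f_sum].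
have -> : (\sum_(0 <= n <oo) (n%:R * first_hit_prob n u v)%:E = (h u)%:E)%E.
  apply/cvg_lim => //; under eq_fun do rewrite sumEFin.
  by apply: cvg_EFin => //; [near=> n | exact: nf_sum].
by rewrite subee // mule0 adde0.
Unshelve. all: by end_near. Qed.

End Hitting.

(** * Trees and edge removal *)

Lemma set2_inj (T : finType) (x y a b : T) :
  [set x; y]%SET = [set a; b]%SET -> (x = a /\ y = b) \/ (x = b /\ y = a).
Proof.
move=> E; have := set21 x y; have := set22 x y; rewrite {1 2}E.
have := set21 a b; have := set22 a b; rewrite -{1 2}E.
move=> /set2P[] bE /set2P[] aE /set2P[] yE /set2P[] xE; subst; auto.
Qed.

(** After its last use of the edge ab, a path stands at a or at b and goes on to z without it; if it
    never uses ab, it does so from its start c. *)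
Lemma connect_del_edge (T : finType) (r r' : rel T) (a b c z : T) :
  (forall x y, r x y -> r' x y \/ [set x; y]%SET = [set a; b]%SET) ->
  connect r c z -> [\/ connect r' c z, connect r' a z | connect r' b z].
Proof.
move=> rr' /connectP[p pP ->]; elim: p c pP => [|d p IH] c /=.
  by rewrite connect0; constructor 1.
move=> /andP[cd /IH[dz|az|bz]]; [|by constructor 2|by constructor 3].
have [cd'|/set2_inj[[_ db]|[_ da]]] := rr' _ _ cd.
- by constructor 1; apply: connect_trans dz; apply: connect1.
- by constructor 3; rewrite -db.
- by constructor 2; rewrite -da.
Qed.

Section Cut.
Variables (R : realType) (G : wgraph R).
Implicit Types (u v w z a b : vertex G) (e : {set vertex G}).

Definition adj_del e : rel (vertex G) := fun a b => adj a b && ([set a; b]%SET != e).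
Definition side e : rel (vertex G) := connect (adj_del e).

Lemma adj_del_sym e : symmetric (adj_del e).
Proof. by move=> a b; rewrite /adj_del adj_sym finset.setUC. Qed.

Lemma side_sym e a b : side e a b = side e b a.
Proof. exact: sym_connect_sym (adj_del_sym e) a b. Qed.

Lemma side_trans e : transitive (side e).
Proof. exact: connect_trans. Qed.

Lemma side_refl e a : side e a a.
Proof. exact: connect0. Qed.

Lemma adj_del_avoid e x a b : x \in e -> adj a b -> x != a -> x != b -> adj_del e a b.
Proof.
move=> xe ab xa xb; rewrite /adj_del ab; apply: contraTneq xe => <-.
by rewrite !inE negb_or xa.
Qed.

Lemma path_side e x a p :
  x \in e -> x \notin a :: p -> path (@adj R G) a p -> side e a (last a p).
Proof.
move=> xe; elim: p a => [|b p IH] a /=; first by rewrite side_refl.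
rewrite !inE !negb_or => /and3P[xa xb xp] /andP[ab bp].
apply: side_trans (IH b _ bp); last by rewrite inE negb_or xb.
exact/connect1/(adj_del_avoid xe).
Qed.

Lemma side_del e a b c z : side e c z ->
  [\/ connect (fun x y => adj_del e x y && adj_del [set a; b]%SET x y) c z,
      connect (fun x y => adj_del e x y && adj_del [set a; b]%SET x y) a z |
      connect (fun x y => adj_del e x y && adj_del [set a; b]%SET x y) b z].
Proof.
apply: connect_del_edge => x y exy.
have [->|ne] := eqVneq [set x; y]%SET [set a; b]%SET; first by right.
by left; rewrite exy /adj_del ne; case/andP: exy => ->.
Qed.

Lemma adj_del2_sideL e f x y :
  connect (fun x y => adj_del e x y && adj_del f x y) x y -> side e x y.
Proof. by apply: connect_sub => a b /andP[ab _]; exact: connect1. Qed.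

Lemma adj_del2_sideR e f x y :
  connect (fun x y => adj_del e x y && adj_del f x y) x y -> side f x y.
Proof. by apply: connect_sub => a b /andP[_ ab]; exact: connect1. Qed.

(** A simple path from u to w avoiding the edge uw has at least two edges, so uw closes it into a
    cycle on at least three vertices. The bound 2 in [is_acyclic] only tolerates degenerate cycles
    such as an edge walked back and forth. *)
Lemma acyclic_bridge u w : is_acyclic G -> adj u w -> ~~ side [set u; w]%SET u w.
Proof.
move=> acG uw; apply/negP => /connectP[p0 p0P wE].
case/shortenP: p0P wE => p pP up _ wE.
have {}pP' : path (@adj R G) u p by apply: sub_path pP => a b /andP[].
have /acG : ucycle (@adj R G) (u :: p).
  by rewrite /ucycle up andbT /= rcons_path pP' -wE adj_sym.
case: p pP wE {up pP'} => [|d [|//]] /=.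
  by move=> _ wE; move: uw; rewrite wE adj_irr.
by move=> /andP[/andP[_ /eqP nuw] _] wE; rewrite wE in nuw.
Qed.

(** The part of a cycle x, y, z, ... from y on avoids x, and its closing edge is not xy, so y still
    reaches x without xy. This lets acyclicity of the modified tree be checked edge by edge. *)
Lemma bridge_acyclic :
  (forall u w, adj u w -> ~~ side [set u; w]%SET u w) -> is_acyclic G.
Proof.
move=> br [|x [|y [|z s]]] //; rewrite /ucycle => /andP[/=].
rewrite rcons_path => /and4P[xy yz zs lx] /and3P[xs ys us].
case/negP: (br _ _ xy); rewrite side_sym.
apply: (side_trans (y := last z s)).
  by apply: (@path_side _ x y (z :: s)); rewrite ?set21 //= yz.
apply: connect1; rewrite /adj_del lx; apply/eqP => /set2_inj[[_ exy]|[exy _]].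
  by rewrite exy mem_head in xs.
by move: ys; rewrite -exy mem_last.
Qed.

Hypothesis treeG : is_tree G.

Let connG u v : connect (@adj R G) u v. Proof. by case: treeG => -[_ +] _; exact. Qed.

Lemma bridge u w : adj u w -> ~~ side [set u; w]%SET u w.
Proof. by apply: acyclic_bridge; case: treeG. Qed.

Lemma side_adj u w z : adj u w -> side [set u; w]%SET w z = ~~ side [set u; w]%SET u z.
Proof.
move=> uw; apply/idP/idP => [wz|].
  apply/negP => uz; case/negP: (bridge uw); apply: side_trans uz _.
  by rewrite side_sym.
have adj_cut x y : adj x y ->
    adj_del [set u; w]%SET x y \/ [set x; y]%SET = [set u; w]%SET.
  by move=> xy; rewrite /adj_del xy; have [->|] := eqVneq; [right|left].
by case: (connect_del_edge adj_cut (connG u z)); rewrite -/(side _ _ _) => ->.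
Qed.

Lemma side_edge_dichotomy e a b c : e \in edges G ->
  ~~ side e a b -> ~~ side e a c -> side e b c.
Proof.
move=> eE; have /eqP/cards2P[u [w [_ E]]] := edges_card eE; subst e.
have uw : adj u w by [].
have := side_adj a uw; have := side_adj b uw; have := side_adj c uw.
have [ua|nua] := boolP (side _ u a) => + + + nab nac.
  have nub : ~~ side [set u; w]%SET u b.
    by apply: contra nab; apply: side_trans; rewrite side_sym.
  have nuc : ~~ side [set u; w]%SET u c.
    by apply: contra nac; apply: side_trans; rewrite side_sym.
  rewrite nub nuc => wc wb _; apply: side_trans wc; by rewrite side_sym.
move=> wc wb wa.
have nwb : ~~ side [set u; w]%SET w b.
  by apply: contra nab; apply: side_trans; rewrite side_sym.
have nwc : ~~ side [set u; w]%SET w c.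
  by apply: contra nac; apply: side_trans; rewrite side_sym.
move: nwb nwc; rewrite wb wc !negbK => ub; apply: side_trans; by rewrite side_sym.
Qed.

(** With both edges removed, one of w1, u, w2 still reaches z. Since w1 stays joined to u when only
    uw2 is removed, and w2 when only uw1 is, u reaches z without one of the two edges. *)
Lemma separating_nbr_unique u w1 w2 z : adj u w1 -> adj u w2 ->
  ~~ side [set u; w1]%SET u z -> ~~ side [set u; w2]%SET u z -> w1 = w2.
Proof.
move=> uw1 uw2 n1 n2; apply/eqP/negPn/negP => ne.
have c12 : side [set u; w1]%SET u w2.
  apply: connect1; rewrite /adj_del uw2; apply/eqP => /set2_inj[[_ e]|[_ e]].
    by rewrite e eqxx in ne.
  by rewrite e adj_irr in uw2.
have c21 : side [set u; w2]%SET u w1.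
  apply: connect1; rewrite /adj_del uw1; apply/eqP => /set2_inj[[_ e]|[_ e]].
    by rewrite e eqxx in ne.
  by rewrite e adj_irr in uw1.
have : side [set u; w1]%SET w1 z by rewrite side_adj.
case/(side_del u w2).
- move/adj_del2_sideR => h; case/negP: n2; exact: side_trans c21 h.
- by move/adj_del2_sideR => h; case/negP: n2.
- move/adj_del2_sideL => h; case/negP: n1; exact: side_trans c12 h.
Qed.

Lemma separating_nbr_exists u z : u != z ->
  exists2 w, adj u w & ~~ side [set u; w]%SET u z.
Proof.
move=> uz; have /connectP[p0 p0P zE] := connG u z.
case/shortenP: p0P zE => -[|w p] /= pP up _ zE; first by rewrite zE eqxx in uz.
move: pP up => /andP[uw wp] /andP[uwp _].
exists w => //; rewrite -side_adj // zE {zE}.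
by apply: (path_side (x := u)); rewrite ?set21.
Qed.

(** The branches at [u] partition the other vertices; this form converts sums over neighbours into
    sums over vertices. *)
Lemma separating_nbr_count u z :
  \sum_(w | adj u w) (~~ side [set u; w]%SET u z)%:R = (u != z)%:R :> R.
Proof.
have [<-|uz] := eqVneq u z.
  by rewrite big1 // => w _; rewrite side_refl.
have [w uw nw] := separating_nbr_exists uz.
rewrite (bigD1 w) //= nw big1 ?addr0 // => x /andP[ux xw].
have [//|nx] := boolP (side _ _ _).
by rewrite (separating_nbr_unique ux uw nx nw) eqxx in xw.
Qed.

End Cut.

(** * The Kemeny constant of a tree *)

Section Kemeny.
Variables (R : realType) (G : wgraph R).
Implicit Types (u v w z a b : vertex G) (e : {set vertex G}).

Definition deg u : R := \sum_(w | adj u w) weight [set u; w]%SET.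
Definition total_deg : R := \sum_u deg u.
(** Degrees are those of [G], so an edge e counts once on each of its sides and every other edge of
    a side counts twice there; hence both sides weigh at least w(e). *)
Definition side_deg e u : R := \sum_(z | side e u z) deg z.
Definition cut_product e u : R := side_deg e u * (total_deg - side_deg e u).

Lemma adj_weight_gt0 u w : adj u w -> 0 < weight [set u; w]%SET.
Proof. exact: weight_gt0. Qed.

Lemma deg_ge0 u : 0 <= deg u.
Proof. by apply: sumr_ge0 => w /adj_weight_gt0/ltW. Qed.

Lemma weight_le_deg u w : adj u w -> weight [set u; w]%SET <= deg u.
Proof.
move=> uw; rewrite /deg (bigD1 w) //= lerDl sumr_ge0 // => z /andP[uz _].
exact/ltW/adj_weight_gt0.
Qed.

Lemma deg_edges u : deg u = \sum_(e in edges G | u \in e) weight e.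
Proof.
rewrite /deg.
rewrite [RHS](eq_bigl (mem [set [set u; w]%SET | w in [set w | adj u w]%SET]%SET)); last first.
  move=> e; apply/andP/imsetP => [[eE ue]|[w]].
    have /eqP/cards2P[a [b [_ E]]] := edges_card eE; subst e.
    case/set2P: ue => ->; first by exists b; rewrite // inE.
    by exists a; rewrite ?inE 1?finset.setUC // /adj finset.setUC.
  by rewrite inE => uw ->; rewrite set21.
rewrite big_imset /=; first by apply: eq_bigl => w; rewrite inE.
move=> a b; rewrite !inE => ua ub /set2_inj[[_ //]|[ub' au]].
by rewrite -ub' adj_irr in ub.
Qed.

Lemma total_deg_edges : total_deg = 2 * \sum_(e in edges G) weight e.
Proof.
rewrite /total_deg; under eq_bigr do rewrite deg_edges big_mkcondr.
rewrite exchange_big mulr_sumr; apply: eq_bigr => e eE /=.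
by rewrite -big_mkcond /= sumr_const edges_card // mulr2n mulrDl mul1r.
Qed.

Lemma side_degC e u : total_deg - side_deg e u = \sum_(z | ~~ side e u z) deg z.
Proof. by rewrite /total_deg (bigID (side e u)) /= addrAC subrr add0r. Qed.

Lemma eq_side_deg e u w : side e u w -> side_deg e u = side_deg e w.
Proof.
move=> uw; apply: eq_bigl => z; apply/idP/idP; apply: side_trans => //.
by rewrite side_sym.
Qed.

Lemma side_deg_ge e u : deg u <= side_deg e u.
Proof.
rewrite /side_deg (bigD1 u) ?side_refl //= lerDl sumr_ge0 // => z _.
exact: deg_ge0.
Qed.

Hypothesis treeG : is_tree G.
Hypothesis edgeG : edges G != finset.set0.

Let connG u v : connect (@adj R G) u v. Proof. by case: treeG => -[_ +] _; exact. Qed.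

Lemma side_deg_adj u w : adj u w ->
  side_deg [set u; w]%SET w = total_deg - side_deg [set u; w]%SET u.
Proof.
by move=> uw; rewrite side_degC; apply: eq_bigl => z; rewrite side_adj.
Qed.

Lemma side_deg_other e u w : e \in edges G -> ~~ side e u w ->
  side_deg e w = total_deg - side_deg e u.
Proof.
move=> eE nuw; rewrite side_degC; apply: eq_bigl => z; apply/idP/idP.
  by move=> wz; apply: contra nuw => uz; apply: side_trans uz _; rewrite side_sym.
by apply: side_edge_dichotomy.
Qed.

(** Changing sides exchanges s and t - s. Each cut may thus be evaluated at whichever vertex is
    convenient. *)
Lemma cut_product_indep e u w : e \in edges G -> cut_product e u = cut_product e w.
Proof.
move=> eE; rewrite /cut_product; have [uw|nuw] := boolP (side e u w).
  by rewrite (eq_side_deg uw).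
by rewrite (side_deg_other eE nuw); ring.
Qed.

Lemma has_nbr u : exists w, adj u w.
Proof.
have /finset.set0Pn[e eE] := edgeG.
have /eqP/cards2P[a [b [ab E]]] := edges_card eE; subst e.
have [z uz] : exists z, u != z.
  by have [->|] := eqVneq u a; [exists b | exists a].
have /connectP[[|w p] /= pP zE] := connG u z; first by rewrite zE eqxx in uz.
by exists w; case/andP: pP.
Qed.

Lemma deg_gt0 u : 0 < deg u.
Proof.
have [w uw] := has_nbr u.
exact: lt_le_trans (adj_weight_gt0 uw) (weight_le_deg uw).
Qed.

Lemma total_deg_gt0 : 0 < total_deg.
Proof.
have [u _] : exists u : vertex G, true.
  by case: treeG => -[/card_gt0P[u _] _] _; exists u.
rewrite /total_deg (bigD1 u) //= ltr_wpDr ?deg_gt0 // sumr_ge0 // => z _.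
exact: deg_ge0.
Qed.

Lemma trans_ge0 u w : 0 <= trans u w.
Proof.
rewrite /trans; case: ifP => // uw.
by rewrite divr_ge0 ?deg_ge0 // ltW // adj_weight_gt0.
Qed.

Lemma sum_trans u (f : vertex G -> R) :
  \sum_w trans u w * f w = (\sum_(w | adj u w) weight [set u; w]%SET * f w) / deg u.
Proof.
rewrite mulr_suml [RHS]big_mkcond; apply: eq_bigr => w _ /=.
by rewrite /trans -/(deg u); case: ifP => _; rewrite ?mul0r // mulrAC.
Qed.

Lemma trans_sum1 u : \sum_w trans u w = 1.
Proof.
under eq_bigr do rewrite -[trans _ _]mulr1.
rewrite sum_trans; under eq_bigr do rewrite mulr1.
by rewrite -/(deg u) divff // gt_eqF // deg_gt0.
Qed.

Lemma sum_branches u :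
  \sum_(w | adj u w) (total_deg - side_deg [set u; w]%SET u) = total_deg - deg u.
Proof.
under eq_bigr do rewrite side_degC big_mkcond.
rewrite exchange_big /=; transitivity (\sum_z (u != z)%:R * deg z).
  apply: eq_bigr => z _; rewrite -(separating_nbr_count treeG) mulr_suml.
  by apply: eq_bigr => w _; case: (side _ _ _); rewrite /= ?mul0r ?mul1r.
rewrite /total_deg [in RHS](bigD1 u) //= addrAC subrr add0r [LHS](bigD1 u) //= eqxx mul0r add0r.
by apply: eq_bigr => z; rewrite eq_sym => ->; rewrite mul1r.
Qed.

(** The edges separating [u] from [v] are those of the path joining them, and each summand is the
    mean time to go from the near end of [e] to its far end. *)
Definition mean_hit v u : R :=
  \sum_(e in edges G | ~~ side e u v) side_deg e u / weight e.

Lemma mean_hitB v u w : adj u w ->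
  weight [set u; w]%SET * (mean_hit v u - mean_hit v w) =
  side_deg [set u; w]%SET u - total_deg + (~~ side [set u; w]%SET u v)%:R * total_deg.
Proof.
move=> uw; rewrite /mean_hit !big_mkcondr /=.
rewrite !(bigD1 (P := mem (edges G)) [set u; w]%SET uw) /=.
(* Every other edge has u and w on the same side, so only the term of uw differs. *)
rewrite (eq_bigr (fun e => if ~~ side e w v then side_deg e w / weight e else 0)); last first.
  move=> e /andP[eE ne].
  have uw' : side e u w by apply: connect1; apply/andP; rewrite eq_sym.
  rewrite (eq_side_deg uw'); congr (if ~~ _ then _ else _); apply/idP/idP.
    by apply: side_trans; rewrite side_sym.
  exact: side_trans.
rewrite side_adj // side_deg_adj //.
have w0 : weight [set u; w]%SET != 0 by rewrite gt_eqF // adj_weight_gt0.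
by case: (side _ u v) => /=; field.
Qed.

(** The weighted drops of [mean_hit v] along the edges at u add up to deg u: the branches give -(t -
    deg u), and the single neighbour towards v gives t. *)
Lemma mean_hitE v u : u != v ->
  mean_hit v u = 1 + \sum_w trans u w * mean_hit v w.
Proof.
move=> uv; apply/eqP; rewrite -subr_eq; apply/eqP.
have -> : mean_hit v u = \sum_w trans u w * mean_hit v u.
  by rewrite -mulr_suml trans_sum1 mul1r.
rewrite -sumrB; under eq_bigr do rewrite -mulrBr.
rewrite sum_trans; under eq_bigr => w uw do rewrite mean_hitB //.
rewrite big_split /= -mulr_suml separating_nbr_count // uv mul1r.
under eq_bigr do rewrite -opprB.
rewrite sumrN sum_branches opprB.
by rewrite subrK divff // gt_eqF // deg_gt0.
Qed.

Lemma tree_hitting_time u v : hitting_time u v = (mean_hit v u)%:E.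
Proof.
apply: hitting_timeE.
- exact: trans_ge0.
- exact: trans_sum1.
- move=> w; apply: sumr_ge0 => e /andP[eE _].
  rewrite divr_ge0 ?sumr_ge0 // => [z _|]; first exact: deg_ge0.
  exact/ltW/weight_gt0.
- by rewrite /mean_hit big1 // => e; rewrite side_refl andbF.
- exact: mean_hitE.
Qed.

Lemma deg_stationary : stationary (fun v => deg v / total_deg).
Proof.
split=> [v||v].
- by rewrite divr_ge0 ?deg_ge0 // ltW // total_deg_gt0.
- by rewrite -mulr_suml divff // gt_eqF // total_deg_gt0.
rewrite /deg mulr_suml [RHS]big_mkcond; apply: eq_bigr => u _ /=.
rewrite /trans adj_sym -/(deg u); case: ifP => _; last by rewrite mulr0.
have d0 := deg_gt0 u; have t0 := total_deg_gt0.
by rewrite finset.setUC; field; rewrite !gt_eqF.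
Qed.

(* Dirichlet form: q = p / deg is harmonic, so its energy
   sum_(u ~ v) weight * (q u - q v)^2 vanishes. *)
Lemma stationary_unique (p : vertex G -> R) :
  stationary p -> forall v, p v = deg v / total_deg.
Proof.
move=> [_ p1 pS]; pose q v := p v / deg v.
have pq v : p v = q v * deg v by rewrite /q divfK // gt_eqF // deg_gt0.
have qS v : \sum_(u | adj u v) weight [set u; v]%SET * (q v - q u) = 0.
  under eq_bigr do rewrite mulrBr; rewrite sumrB.
  apply/eqP; rewrite subr_eq0 -mulr_suml; apply/eqP.
  transitivity (p v).
    rewrite pq mulrC; congr (_ * _); rewrite /deg; apply: eq_big => u.
      by rewrite adj_sym.
    by rewrite finset.setUC.
  rewrite -[LHS]pS [RHS]big_mkcond; apply: eq_bigr => u _ /=.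
  rewrite /trans -/(deg u); case: ifP => _; last by rewrite mulr0.
  by rewrite /q; ring.
have energy : \sum_v \sum_(u | adj u v) weight [set u; v]%SET * (q v - q u) ^+ 2 = 0.
  have E1 : \sum_v \sum_(u | adj u v) weight [set u; v]%SET * (q v - q u) * q v = 0.
    by rewrite big1 // => v _; rewrite -mulr_suml qS mul0r.
  (* Swapping the ends of every edge turns this sum into minus the previous one; the difference of
     the two is the energy. *)
  have E2 : \sum_v \sum_(u | adj u v) weight [set u; v]%SET * (q v - q u) * q u = 0.
    transitivity (- \sum_v \sum_(u | adj u v) weight [set u; v]%SET * (q v - q u) * q v);
      last by rewrite E1 oppr0.
    rewrite (exchange_big_dep predT) //= -sumrN; apply: eq_bigr => v _.
    rewrite -sumrN; apply: eq_big => u; first by rewrite adj_sym.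
    by move=> _; rewrite finset.setUC; ring.
  have := congr2 (fun x y => x - y) E1 E2; rewrite /= subrr => E12.
  rewrite -[RHS]E12 -sumrB; apply: eq_bigr => v _.
  by rewrite -sumrB; apply: eq_bigr => u _; ring.
have q_adj u v : adj u v -> q u = q v.
  move=> uv; have terms_ge0 x y : adj x y -> 0 <= weight [set x; y]%SET * (q y - q x) ^+ 2.
    by move=> /adj_weight_gt0/ltW ?; rewrite mulr_ge0 // sqr_ge0.
  have := energy => /eqP; rewrite psumr_eq0; last first.
    by move=> y _; apply: sumr_ge0 => x; exact: terms_ge0.
  move=> /allP /(_ v); rewrite mem_index_enum => /(_ isT) /=.
  rewrite psumr_eq0; last by move=> x; exact: terms_ge0.
  move=> /allP /(_ u); rewrite mem_index_enum uv => /(_ isT) /=.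
  rewrite mulf_eq0 gt_eqF ?adj_weight_gt0 //= sqrf_eq0 subr_eq0.
  by move/eqP.
have q_const u v : q u = q v.
  have /connectP[s sP ->] := connG u v.
  elim: s u sP => //= w s IH u /andP[uw ws].
  by rewrite (q_adj _ _ uw); exact: IH.
move=> v; rewrite pq.
have : q v * total_deg = 1.
  rewrite /total_deg mulr_sumr -[RHS]p1; apply: eq_bigr => u _.
  by rewrite pq (q_const u v).
by move/(canRL (mulfK (lt0r_neq0 total_deg_gt0))) => ->; rewrite mul1r mulrC.
Qed.

(** Existence ensures that [xget] does not return its default value, and uniqueness identifies its
    choice. *)
Lemma stationary_distE v : stationary_dist v = deg v / total_deg.
Proof.
apply: stationary_unique.
by apply: (@xgetPex _ (fun=> 0) [set p | stationary p]%classic); exists (fun v => deg v / total_deg); exact: deg_stationary.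
Qed.

Lemma kemenyE u :
  kemeny G = ((\sum_(e in edges G) cut_product e u / weight e) / total_deg)%:E.
Proof.
rewrite /kemeny; case: pickP => [x _|/(_ u)//].
rewrite /kemeny_from; under eq_bigr do rewrite tree_hitting_time stationary_distE -EFinM.
rewrite sumEFin; congr (_%:E).
rewrite mulr_suml; under eq_bigr do rewrite /mean_hit big_mkcondr mulr_suml.
rewrite exchange_big /=; apply: eq_bigr => e eE.
rewrite (cut_product_indep u x) // /cut_product side_degC mulr_sumr !mulr_suml.
rewrite [RHS]big_mkcond; apply: eq_bigr => z _.
case: (side _ _ _) => /=; rewrite ?mul0r //.
by rewrite -mulr_suml -/(side_deg e x); ring.
Qed.

End Kemeny.

(** * Stars *)

Lemma edge_weights_sum (R : realType) (W : {mset R}) (T : wgraph R) (g : R -> R) :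
  edge_weights T = W ->
  \sum_(e in edges T) g (weight e) = \sum_(x <- enum_mset W) g x.
Proof.
move=> TW; have /eq_seq_msetP pT : edge_weights T = seq_mset (enum_mset W).
  by rewrite seq_mset_id.
by rewrite -(perm_big _ pT) /= big_map big_enum.
Qed.

Lemma in_TW_edges_neq0 (R : realType) (W : {mset R}) (T : wgraph R) :
  W <> mset0 -> in_TW W T -> edges T != finset.set0.
Proof.
move=> W0 [_ TW]; apply/eqP => E0; apply: W0; rewrite -TW /edge_weights E0.
by rewrite enum_set0 /=; apply/msetP => x; rewrite mset_seqE mset0E.
Qed.

Section Star.
Variables (R : realType) (G : wgraph R).
Implicit Types (u v w z a b x y : vertex G) (e : {set vertex G}).

Lemma leaf_side x y z : (forall w, adj x w -> w = y) ->
  side [set x; y]%SET x z = (z == x).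
Proof.
move=> leafx; apply/idP/eqP => [|->]; last exact: side_refl.
move=> /connectP[[|w p] //= /andP[/andP[xw /eqP ne] _] _].
by rewrite (leafx _ xw) in ne.
Qed.

Lemma leaf_side_deg x y : adj x y -> (forall w, adj x w -> w = y) ->
  side_deg [set x; y]%SET x = weight [set x; y]%SET.
Proof.
move=> xy leafx; rewrite /side_deg (big_pred1 x) => [|z]; last exact: leaf_side.
rewrite /deg (big_pred1 y) // => w; apply/idP/eqP => [|->//]; exact: leafx.
Qed.

(** A second neighbour of x would push deg x, a lower bound of [side_deg], strictly above the weight
    of xy. *)
Lemma side_deg_weight_leaf x y : adj x y ->
  side_deg [set x; y]%SET x = weight [set x; y]%SET ->
  forall w, adj x w -> w = y.
Proof.
move=> xy sx w xw; apply/eqP/negPn/negP => wy.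
have := side_deg_ge [set x; y]%SET x; rewrite sx /deg (bigD1 y) //= gerDl.
rewrite leNgt (bigD1 w) /=; last by rewrite xw wy.
rewrite ltr_wpDr ?adj_weight_gt0 // sumr_ge0 // => z /andP[/andP[xz _] _].
exact/ltW/adj_weight_gt0.
Qed.

Hypothesis treeG : is_tree G.
Hypothesis edgeG : edges G != finset.set0.

(** With a and b the two sides, t = a + b and a b - w (t - w) = (a - w) (b - w), which gives both
    the inequality and its equality case. *)
Lemma cut_product_leif x y u : adj x y -> let e := [set x; y]%SET in
  weight e * (total_deg G - weight e) <= cut_product e u
  ?= iff (side_deg e x == weight e) || (side_deg e y == weight e).
Proof.
move=> xy e; have eE : e \in edges G by [].
rewrite (cut_product_indep treeG u x eE) /cut_product.
have sx : weight e <= side_deg e x.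
  exact: le_trans (weight_le_deg xy) (side_deg_ge _ _).
have sy : weight e <= side_deg e y.
  apply: le_trans (side_deg_ge _ _); rewrite /e finset.setUC.
  by apply: weight_le_deg; rewrite adj_sym.
have : side_deg e y = total_deg G - side_deg e x by exact: side_deg_adj.
move: (side_deg e x) (side_deg e y) (weight e) (total_deg G) sx sy.
move=> a b w t wa wb bE; have -> : t = a + b by rewrite bE; ring.
split; first by nra.
have -> : (w * (a + b - w) == a * (a + b - a)) = ((a - w) * (b - w) == 0).
  by rewrite -subr_eq0 -oppr_eq0; congr (_ == _); ring.
by rewrite mulf_eq0 !subr_eq0.
Qed.

Lemma kemeny_ge :
  (((\sum_(e in edges G) (total_deg G - weight e)) / total_deg G)%:E <= kemeny G)%E.
Proof.
have [u _] : exists u : vertex G, true.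
  by case: treeG => -[/card_gt0P[u _] _] _; exists u.
rewrite (kemenyE treeG edgeG u) lee_fin ler_pM2r ?invr_gt0 ?total_deg_gt0 //.
apply: ler_sum => e eE; have /eqP/cards2P[x [y [_ E]]] := edges_card eE; subst e.
by rewrite ler_pdivlMr ?weight_gt0 // mulrC cut_product_leif.
Qed.

Lemma kemeny_minimal_leaf_edges x y :
  kemeny G = ((\sum_(e in edges G) (total_deg G - weight e)) / total_deg G)%:E ->
  adj x y -> (forall w, adj x w -> w = y) \/ (forall w, adj y w -> w = x).
Proof.
rewrite (kemenyE treeG edgeG x) => -[/(mulIf (invr_neq0 (lt0r_neq0 (total_deg_gt0 treeG edgeG))))].
move/eqP; rewrite -subr_eq0 -sumrB psumr_eq0 => [/allP sum0 xy|e eE]; last first.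
  have /eqP/cards2P[a [b [_ E]]] := edges_card eE; subst e.
  by rewrite subr_ge0 ler_pdivlMr ?weight_gt0 // mulrC cut_product_leif.
have := sum0 [set x; y]%SET (mem_index_enum _).
have w0 : weight [set x; y]%SET != 0 by rewrite lt0r_neq0 ?adj_weight_gt0.
have xyE : [set x; y]%SET \in edges G by [].
rewrite xyE /= subr_eq0 -(inj_eq (mulIf w0)) divfK // mulrC eq_sym.
rewrite cut_product_leif // => /orP[/eqP|/eqP]; [left|right].
  exact: side_deg_weight_leaf.
by apply: side_deg_weight_leaf; rewrite 1?adj_sym // finset.setUC.
Qed.

Lemma leaf_edges_star :
  (forall x y, adj x y -> (forall w, adj x w -> w = y) \/ (forall w, adj y w -> w = x)) ->
  is_star G.
Proof.
move=> leafE.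
have [a [b [ab leafb]]] : exists a b, adj a b /\ forall w, adj b w -> w = a.
  have /finset.set0Pn[e eE] := edgeG.
  have /eqP/cards2P[a [b [_ E]]] := edges_card eE; subst e.
  case: (leafE a b eE) => leaf; last by exists a, b.
  by exists b, a; split=> //; rewrite adj_sym.
(* If the edge ax has its leaf end at a, then x is the only neighbour of a, so x = b, whose only
   neighbour is a. *)
have nbr x w : adj a x -> adj x w -> w = a.
  move=> ax xw; case: (leafE _ _ ax) => leaf; last exact: leaf.
  by apply: leafb; rewrite (leaf _ ab).
have spoke x : x != a -> adj a x.
  have near_path p : forall c, path (@adj R G) c p -> c = a \/ adj a c ->
      last c p = a \/ adj a (last c p).
    elim: p => //= w p IH c /andP[cw wp] ac; apply: IH => //.
    by case: ac => [<-|ac]; [right | left; exact: nbr ac cw].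
  have [[_ connG] _] := treeG; have /connectP[p pP ->] := connG a x.
  by case: (near_path p a pP) => [|->|//]; [left | rewrite eqxx].
exists a => u v; apply/idP/andP => [uv|[uv /orP[/eqP ua|/eqP va]]].
- split; first by apply: contraTneq uv => ->; rewrite adj_irr.
  have [//|/= ua] := eqVneq u a; apply/eqP; exact: nbr (spoke _ ua) uv.
- by rewrite ua; apply: spoke; rewrite -ua eq_sym.
- by rewrite va adj_sym; apply: spoke; rewrite -va.
Qed.

Lemma star_kemeny : is_star G ->
  kemeny G = ((\sum_(e in edges G) (total_deg G - weight e)) / total_deg G)%:E.
Proof.
move=> [c cP]; rewrite (kemenyE treeG edgeG c); congr ((_ / _)%:E).
apply: eq_bigr => e eE; have w0 : weight e != 0 by rewrite lt0r_neq0 ?weight_gt0.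
apply: (mulIf w0); rewrite divfK // [RHS]mulrC.
have /eqP/cards2P[x [y [xy E]]] := edges_card eE; subst e.
have leaf v : v != c -> forall w, adj v w -> w = c.
  by move=> vc w; rewrite cP (negbTE vc) => /andP[_ /eqP].
have exy : adj x y by [].
apply/esym/eqP; rewrite cut_product_leif //.
move: (exy); rewrite cP xy /= => /orP[] /eqP ec.
  rewrite finset.setUC leaf_side_deg ?eqxx ?orbT //; first by rewrite adj_sym.
  by rewrite ec; apply: leaf; rewrite -ec eq_sym.
rewrite leaf_side_deg ?eqxx //.
by rewrite ec; apply: leaf; rewrite -ec.
Qed.

End Star.

(** * Paths *)

Section Path.
Variables (R : realType) (G : wgraph R).
Implicit Types (u v w z a b x y : vertex G).
Hypothesis treeG : is_tree G.

(** A longest simple path contains all neighbours of its vertices: a missing one would prolong it at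
    an end, or be a third neighbour of an interior vertex. By connectivity it covers the tree, and a
    chord would not be a bridge. *)
Lemma degree_le2_path :
  (forall v x y z, adj v x -> adj v y -> adj v z ->
     x != y -> x != z -> y != z -> False) -> is_path G.
Proof.
move=> deg2; have [[/card_gt0P[x0 _] connG] _] := treeG.
pose P n := [exists t : n.-tuple (vertex G), uniq t && sorted (@adj R G) t].
have P1 : exists n, P n by exists 1%N; apply/existsP; exists [tuple x0].
have Pb n : P n -> (n <= #|vertex G|)%N.
  by move=> /existsP[t /andP[ut _]]; rewrite -(size_tuple t) -(card_uniqP ut) max_card.
case: (ex_maxnP P1 Pb) => n /existsP[t /andP[ut st]] nmax.
have longest (s : seq (vertex G)) : uniq s -> sorted (@adj R G) s -> (size s <= n)%N.
  by move=> us ss; apply: nmax; apply/existsP; exists (in_tuple s); rewrite us.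
have n0 : (0 < n)%N by apply: (longest [:: x0]).
have szt := size_tuple t; move: (tval t) ut st szt => s us ss szs {t}.
have consec i : (i.+1 < n)%N -> adj (nth x0 s i) (nth x0 s i.+1).
  by rewrite -szs; move/(sortedP x0): ss; apply.
have s_closed a b : a \in s -> adj a b -> b \in s.
  move=> sa ab; apply/negPn/negP => sb.
  have := sa; rewrite -index_mem szs; set i := index a s => lti.
  have ia : nth x0 s i = a by rewrite nth_index.
  case: (posnP i) => [i0|i_gt0].
    have := longest (b :: s); rewrite /= sb us szs ltnn => /(_ isT) lng.
    suff /lng : path (@adj R G) b s by [].
    move: ss ia; rewrite i0; clear -ab.
    by case: s => //= c s cs ca; rewrite cs ca adj_sym ab.
  have [lti1|lei1] := ltnP i.+1 n.
    have predi : adj a (nth x0 s i.-1).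
      by rewrite adj_sym -ia -{2}(prednK i_gt0) consec ?prednK.
    have succi : adj a (nth x0 s i.+1) by rewrite -ia consec.
    have ltp : (i.-1 < size s)%N by rewrite szs prednK // ltnW.
    apply: (deg2 _ _ _ _ predi succi ab).
    - rewrite nth_uniq ?szs // -?szs //; apply/eqP; lia.
    - by apply: contraNneq sb => <-; rewrite mem_nth.
    - by apply: contraNneq sb => <-; rewrite mem_nth // szs.
  have iE : i.+1 = n by apply/eqP; rewrite eqn_leq lti.
  have := longest (rcons s b); rewrite rcons_uniq sb us size_rcons szs ltnn => /(_ isT) lng.
  suff /lng : sorted (@adj R G) (rcons s b) by [].
  apply/(sortedP x0) => k; rewrite size_rcons szs ltnS => ltk.
  rewrite !nth_rcons szs ltk; case: (ltngtP k.+1 n) => [ltk1|gtk1|kn].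
  - exact: consec.
  - by rewrite ltnNge ltk in gtk1.
  by have -> : k = i by [apply: succn_inj; rewrite kn]; rewrite ia.
have s_all b : b \in s.
  have /connectP[p pP ->] := connG (nth x0 s 0%N) b.
  have : nth x0 s 0%N \in s by rewrite mem_nth // szs.
  elim: p (nth x0 s 0%N) pP => //= d p IH c /andP[cd dp] sc.
  exact: IH dp (s_closed _ _ sc cd).
have nadj i j : (i < j < n)%N -> adj (nth x0 s i) (nth x0 s j) -> i.+1 = j.
  move=> /andP[ij jn] aij; apply/eqP; move: ij; rewrite leq_eqVlt => /orP[//|ij].
  exfalso; set e := [set nth x0 s i; nth x0 s j]%SET.
  have := bridge treeG aij; rewrite -/e => /negP; apply.
  have ne k : (i < k < n)%N -> nth x0 s i != nth x0 s k.
    move=> /andP[ik kn]; rewrite nth_uniq ?szs //; last exact: ltn_trans kn.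
    by rewrite neq_ltn ik.
  have in1 : (i.+1 < n)%N by exact: ltn_trans jn.
  have side1 : side e (nth x0 s i) (nth x0 s i.+1).
    apply: connect1; apply/andP; split; first exact: consec.
    apply/eqP => /set2_inj[[_ /eqP]|[/eqP]].
      by rewrite nth_uniq ?szs //; apply/negP; rewrite neq_ltn ij.
    by move: (ne j); rewrite jn (ltn_trans _ ij) // => /(_ isT)/negbTE ->.
  apply: side_trans side1 _.
  have : (i.+1 <= j)%N by exact: ltnW.
  have : (j <= j)%N by [].
  (* Only the end of the stretch starting at i + 1 is generalized to k; [e] keeps its end at j. The
     stretch avoids the vertex of index i, hence [e]. *)
  move: {1 3 4}j => k; elim: k => // k IH kj.
  rewrite leq_eqVlt => /orP[/eqP[->]|ik]; first exact: side_refl.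
  apply: side_trans (IH (ltnW kj) ik) _; apply: connect1.
  have kn : (k.+1 < n)%N by exact: leq_ltn_trans jn.
  apply: (@adj_del_avoid _ _ e (nth x0 s i)); first exact: set21.
  - exact: consec.
  - by apply: ne; apply/andP; split; [exact: ik | exact: ltnW].
  - by apply: ne; rewrite kn andbT; exact: ltnW ik.
exists n, (fun i : 'I_n => nth x0 s i); split.
  have lt_idx b : (index b s < n)%N by rewrite -szs index_mem.
  exists (fun b => Ordinal (lt_idx b)) => [i|b]; last by rewrite /= nth_index.
  by apply: val_inj; rewrite /= index_uniq ?szs.
move=> i j; apply/idP/orP => [aij|[/eqP e|/eqP e]].
- case: (ltngtP i j) => [ij|ji|/val_inj e].
  + by left; apply/eqP/nadj; rewrite // ij /=.
  + by right; apply/eqP/nadj; rewrite ?ji //= adj_sym.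
  + by rewrite e adj_irr in aij.
- by rewrite -e consec // e.
- by rewrite adj_sym -e consec // e.
Qed.

End Path.

(** * Moving a branch *)

Section Exchange.
Variables (R : realType) (G : wgraph R).
Hypothesis treeG : is_tree G.
Variables (v x y z : vertex G).
Hypotheses (vx : adj v x) (vy : adj v y) (vz : adj v z).
Hypotheses (xy : x != y) (xz : x != z) (yz : y != z).

Let evx := [set v; x]%SET.
Let evy := [set v; y]%SET.
Let eyx := [set y; x]%SET.
Let w0 := weight evx.

Let xv : x != v. Proof. by apply: contraTneq vx => ->; rewrite adj_irr. Qed.
Let yv : y != v. Proof. by apply: contraTneq vy => ->; rewrite adj_irr. Qed.

Let evy_evx : evy != evx.
Proof.
apply/eqP => /set2_inj[[_ e]|[e _]]; first by move: xy; rewrite e eqxx.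
by move: xv; rewrite e eqxx.
Qed.

Let side_vx_y : side evx v y.
Proof. by apply: connect1; apply/andP. Qed.

Let nside_vx_y : ~~ side evx x y.
Proof. by rewrite side_adj // negbK. Qed.

Let nyx : eyx \notin edges G.
Proof.
apply/negP => yx; case/negP: nside_vx_y; rewrite side_sym; apply: connect1.
apply/andP; split=> //; apply/eqP => /set2_inj[[e _]|[e _]].
  by move: yv; rewrite e eqxx.
by move: xy; rewrite e eqxx.
Qed.

Let edges_neq_yx e : e \in edges G -> e != eyx.
Proof. by apply: contraTneq => ->. Qed.

Definition exchange_edges : {set {set vertex G}} := (eyx |: (edges G :\ evx))%SET.
(** In [G], yx is not an edge and its [weight] is arbitrary, so the weight of the removed edge is
    put there explicitly. *)
Definition exchange_weight (e : {set vertex G}) : R := if e == eyx then w0 else weight e.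

Lemma exchange_edges_card e : e \in exchange_edges -> #|e| = 2%N.
Proof.
rewrite !inE => /orP[/eqP->|/andP[_ /edges_card]//].
by rewrite cards2 eq_sym xy.
Qed.

Lemma exchange_weight_gt0 e : e \in exchange_edges -> 0 < exchange_weight e.
Proof.
rewrite !inE /exchange_weight; case: eqP => [_ _|_ /= /andP[_ /weight_gt0]//].
exact: adj_weight_gt0.
Qed.

Definition exchange : wgraph R := WGraph exchange_edges_card exchange_weight_gt0.

Let adj' : rel (vertex G) := @adj R exchange.
Let side' e : rel (vertex G) := @side R exchange e.
Let del' e : rel (vertex G) := @adj_del R exchange e.

Let adj'E a b :
  adj' a b = ([set a; b]%SET == eyx) || ([set a; b]%SET != evx) && adj a b.
Proof. by rewrite /adj' /adj !inE. Qed.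

Let side'_sym e a b : side' e a b = side' e b a.
Proof. exact: side_sym. Qed.

Let del'E e a b : del' e a b = adj' a b && ([set a; b]%SET != e). Proof. by []. Qed.

Let del'W e a b : adj_del e a b -> [set a; b]%SET != evx -> del' e a b.
Proof. by move=> /andP[ab ne] nvx; rewrite del'E adj'E nvx ab orbT. Qed.

Let del'_yx e : eyx != e -> del' e y x.
Proof. by move=> ne; rewrite del'E adj'E eqxx. Qed.

Let exchange_sum (F : {set vertex G} -> R) :
  \sum_(e in edges exchange) F e + F evx = \sum_(e in edges G) F e + F eyx.
Proof.
rewrite /= /exchange_edges big_setU1 /=; last by rewrite !inE negb_and nyx orbT.
by rewrite (big_setD1 evx vx) /=; ring.
Qed.

Let weight'E e : e \in edges G -> exchange_weight e = weight e.
Proof. by move=> /edges_neq_yx/negbTE ne; rewrite /exchange_weight ne. Qed.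

Let weight'_yx : exchange_weight eyx = w0.
Proof. by rewrite /exchange_weight eqxx. Qed.

(** Such an edge leaves v, x and y together in both graphs, so the detour v, y, x replaces vx, and
    y, v, x replaces yx. *)
Let side'_other e : e \in edges G -> e != evx -> e != evy -> side' e =2 side e.
Proof.
move=> eE nvx nvy a b.
have cvy : adj_del e v y by apply/andP; rewrite eq_sym.
have cvx : adj_del e v x by apply/andP; rewrite eq_sym.
apply/idP/idP; apply: connect_sub => {a b} a b.
  move=> /andP[]; rewrite -/(adj' a b) adj'E => /orP[/eqP|/andP[_ ab] ne]; last first.
    by apply: connect1; apply/andP.
  have yx : side e y x.
    by apply: (side_trans (y := v)); [rewrite side_sym|]; exact: connect1.
  by move=> /set2_inj[[-> ->]|[-> ->]] _ //; rewrite -/(side e x y) side_sym.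
move=> cab; have [E|ne] := eqVneq [set a; b]%SET evx; last first.
  by apply: connect1; exact: del'W.
have v'x : side' e v x.
  apply: (side_trans (y := y : vertex exchange)); apply: connect1.
    exact: del'W.
  by apply: del'_yx; rewrite eq_sym; exact: edges_neq_yx.
move: E => /set2_inj[[-> ->]|[-> ->]]; first exact: v'x.
by change (side' e x v); rewrite side'_sym.
Qed.

Let side'_yx : side' eyx =2 side evx.
Proof.
apply: eq_connect => a b; rewrite -/(del' eyx a b) del'E adj'E /adj_del.
have [E|ne] := eqVneq [set a; b]%SET eyx.
  by rewrite /= ?andbF /adj E (negbTE nyx).
by rewrite /= andbT andbC.
Qed.

Let del2 := fun a b => adj_del evx a b && adj_del evy a b.

Let del2_sym : symmetric del2.
Proof. by move=> a b; rewrite /del2 !(adj_del_sym _ a). Qed.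

Let del2E t : connect del2 v t = side evx v t && side evy v t.
Proof.
apply/idP/andP => [h|[tx ty]].
  by split; [exact: adj_del2_sideL h | exact: adj_del2_sideR h].
case: (side_del v y tx) => // /adj_del2_sideR.
by rewrite side_adj // ty.
Qed.

(** The component of v in [G] without vx and vy stays closed after the exchange, because both ends
    of the new edge yx lie outside it. *)
Let side'_vy t : side' evy v t = side evx v t && side evy v t.
Proof.
rewrite -del2E; apply/idP/idP; last first.
  apply: connect_sub => a b /andP[/andP[_ nvx] cvy].
  apply: connect1; exact: del'W.
have cl : fingraph.closed (del' evy) (connect del2 v).
  have nvy : ~~ connect del2 v y by rewrite del2E (negbTE (bridge treeG vy)) andbF.
  have nvx : ~~ connect del2 v x by rewrite del2E (negbTE (bridge treeG vx)).
  move=> a b; rewrite del'E adj'E => /andP[/orP[/eqP|]].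
    by move=> /set2_inj[[-> ->]|[-> ->]] _; rewrite -!topredE /= (negbTE nvx) (negbTE nvy).
  move=> /andP[nvx' ab] nvy'; rewrite -!topredE /=.
  have c2 : del2 a b by rewrite /del2 /adj_del ab nvx' nvy'.
  apply/idP/idP => h; apply: connect_trans h _; apply: connect1 => //.
  by rewrite del2_sym.
by move=> /(closed_connect cl); rewrite -!topredE /= connect0 => <-.
Qed.

Lemma exchange_tree : is_tree exchange.
Proof.
have [[V0 connG] acG] := treeG; split.
  split=> // a b; move: (connG a b); apply: connect_sub => {a b} a b ab.
  have [E|ne] := eqVneq [set a; b]%SET evx; last first.
    by apply: connect1; rewrite -/(adj' a b) adj'E ne ab orbT.
  have v'x : connect adj' v x.
    apply: (connect_trans (y := y)); apply: connect1; rewrite adj'E ?eqxx //.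
    by rewrite evy_evx vy orbT.
  move: E => /set2_inj[[-> ->]|[-> ->]] //.
  change (connect adj' x v); by rewrite (sym_connect_sym (@adj_sym _ exchange)).
apply: bridge_acyclic => u w uw.
set e := [set u; w]%SET; have : adj' u w by [].
rewrite adj'E -/e => /orP[/eqP eE|/andP[nevx euw]].
  change (~~ side' e u w); rewrite eE side'_yx; move/set2_inj: eE => [[-> ->]|[-> ->]] //.
  by rewrite side_sym.
have [eE|nevy] := eqVneq e evy.
  have nvy : ~~ side' evy v y by rewrite side'_vy (negbTE (bridge treeG vy)) andbF.
  change (~~ side' e u w); rewrite eE; move/set2_inj: eE => [[-> ->]|[-> ->]] //.
  by rewrite side'_sym.
change (~~ side' e u w); rewrite side'_other //; exact: bridge.
Qed.

Lemma exchange_edge_weights : edge_weights exchange = edge_weights G.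
Proof.
apply/eq_seq_msetP; have p1 : perm_eq (enum (edges G)) (evx :: enum (edges G :\ evx)%SET).
  apply: uniq_perm; rewrite /= ?enum_uniq ?mem_enum ?inE ?eqxx // => e.
  by rewrite inE !mem_enum !inE; have [->|] := eqVneq.
have p2 : perm_eq (enum exchange_edges) (eyx :: enum (edges G :\ evx)%SET).
  apply: uniq_perm; rewrite /= ?enum_uniq ?mem_enum ?inE ?(negbTE nyx) ?andbF // => e.
  by rewrite inE !mem_enum !inE.
apply: (perm_trans (perm_map _ p2)); rewrite perm_sym.
apply: (perm_trans (perm_map _ p1)); rewrite /= weight'_yx perm_cons.
rewrite (_ : map _ _ = [seq exchange_weight e | e <- enum (edges G :\ evx)%SET]) //.
by apply/eq_in_map => e; rewrite mem_enum !inE => /andP[_ eE]; rewrite weight'E.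
Qed.

Let total_deg' : total_deg exchange = total_deg G.
Proof.
rewrite !total_deg_edges; congr (_ * _).
by rewrite (edge_weights_sum id exchange_edge_weights) (edge_weights_sum id (erefl (edge_weights G))).
Qed.

(** The vertex x trades one edge for another of the same weight; only v loses [w0] and y gains it. A
    side degree then changes only if its cut separates v from y. *)
Let deg'E (t : vertex G) : @deg R exchange t = deg t + w0 * ((t == y)%:R - (t == v)%:R).
Proof.
rewrite !deg_edges !big_mkcondr /=.
have := exchange_sum (fun e => if t \in e then exchange_weight e else 0).
have -> : \sum_(e in edges G) (if t \in e then exchange_weight e else 0) =
          \sum_(e in edges G) (if t \in e then weight e else 0).
  by apply: eq_bigr => e eE; rewrite weight'E.
rewrite weight'_yx weight'E // => /(canRL (addrK _)) ->.
rewrite -/w0 -addrA; congr (_ + _); rewrite !inE.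
have [->|tx] := eqVneq t x; first by rewrite (negbTE xy) (negbTE xv) /=; ring.
have [->|ty] := eqVneq t y; first by rewrite (negbTE yv) /=; ring.
by case: (t == v) => /=; ring.
Qed.

Let side_deg'E e (u : vertex G) : @side_deg R exchange e u =
  \sum_(t | side' e u t) deg t + w0 * ((side' e u y)%:R - (side' e u v)%:R).
Proof.
have sum_pred1 a : \sum_(t | side' e u t) (t == a)%:R = (side' e u a)%:R :> R.
  rewrite big_mkcond (bigD1 a) //= eqxx big1 ?addr0 => [|t /negbTE->].
    by case: (side' e u a).
  by rewrite if_same.
rewrite -!sum_pred1 -sumrB mulr_sumr -big_split.
by apply: eq_bigr => t _; exact: deg'E.
Qed.

Let cut_product'_other e : e \in edges G -> e != evx -> e != evy ->
  @cut_product R exchange e v = cut_product e v.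
Proof.
move=> eE nvx nvy; rewrite /cut_product total_deg' side_deg'E.
rewrite !side'_other // side_refl.
have -> : side e v y by apply: connect1; apply/andP; rewrite eq_sym.
rewrite subrr mulr0 addr0 (_ : \sum_(t | _) _ = side_deg e v) //.
by apply: eq_bigl => t; rewrite side'_other.
Qed.

Let cut_product'_yx : @cut_product R exchange eyx x = cut_product evx x.
Proof.
rewrite /cut_product total_deg' side_deg'E !side'_yx.
rewrite (negbTE nside_vx_y) side_adj // side_refl subrr mulr0 addr0.
rewrite (_ : \sum_(t | _) _ = side_deg evx x) //.
by apply: eq_bigl => t; rewrite side'_yx.
Qed.

Let side_deg'_vy : @side_deg R exchange evy v =
  total_deg G - side_deg evx x - side_deg evy y - w0.
Proof.
rewrite side_deg'E !side'_vy !side_refl (negbTE (bridge treeG vy)) andbF /=.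
rewrite sub0r mulrN1; congr (_ - _).
rewrite !side_deg_adj // !side_degC /total_deg.
rewrite big_mkcond [X in _ - X - _]big_mkcond [X in _ - X]big_mkcond /= -!sumrB.
apply: eq_bigr => t _; rewrite side'_vy.
have [tx|ntx] := boolP (side evx v t); have [ty|nty] := boolP (side evy v t) => /=; try ring.
(* The remaining case, a vertex in both branches x and y, is impossible. *)
by have := xy; rewrite (separating_nbr_unique treeG vx vy ntx nty) eqxx.
Qed.

Hypothesis yz_le : side_deg evy y <= side_deg [set v; z]%SET z.

(** Write sx, sy, sz for the branch degree sums and d = sx + w0. At vy, the product sy (t - sy)
    becomes (sy + d) (t - sy - d), a gain of d (t - 2 sy - d). *)
Lemma exchange_kemeny : (kemeny G < kemeny exchange)%E.
Proof.
have edgeG : edges G != finset.set0 by apply/finset.set0Pn; exists evx.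
have edge' : edges exchange != finset.set0.
  by apply/finset.set0Pn; exists eyx; rewrite !inE eqxx.
rewrite (kemenyE treeG edgeG v) (kemenyE exchange_tree edge' v) total_deg'.
rewrite lte_fin ltr_pM2r ?invr_gt0 ?total_deg_gt0 //.
have yxE : eyx \in edges exchange by rewrite !inE eqxx.
have := exchange_sum (fun e => @cut_product R exchange e v / exchange_weight e).
rewrite weight'_yx weight'E // (cut_product_indep exchange_tree v x yxE) cut_product'_yx.
rewrite (cut_product_indep treeG x v vx) => /(canRL (addrK _)).
rewrite [X in X = _ -> _](_ : _ =
  \sum_(e in edges exchange) @cut_product R exchange e v / @weight R exchange e) // => ->.
(* The new cut product at [evx], no longer an edge, cancels, and the old term of vx equals the new
   term of yx. *)
rewrite (bigD1 evx) //= [in X in _ < X](bigD1 evx) //= weight'E //.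
rewrite -/evx -/w0 addrAC [X in _ < X + _]addrAC subrr add0r addrC ltrD2r.
rewrite (bigD1 evy) ?evy_evx ?andbT //= [in X in _ < X](bigD1 evy) ?evy_evx ?andbT //=.
rewrite weight'E //; apply: ltr_leD; last first.
  rewrite le_eqVlt; apply/orP; left; apply/eqP/eq_bigr => e /andP[/andP[eE nvx] nvy].
  by rewrite cut_product'_other // weight'E.
rewrite ltr_pM2r ?invr_gt0 ?adj_weight_gt0 //.
rewrite (cut_product_indep treeG v y vy) /cut_product total_deg' side_deg'_vy.
have := sum_branches treeG v.
under eq_bigr => w vw do rewrite -side_deg_adj //.
rewrite (bigD1 x) //= (bigD1 y) ?vy 1?eq_sym //= (bigD1 z) /=; last first.
  by rewrite vz eq_sym xz eq_sym yz.
rewrite -/evx -/evy.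
set S := (X in _ + (_ + (_ + X))).
have S0 : 0 <= S by apply: sumr_ge0 => w _; apply: sumr_ge0 => t _; exact: deg_ge0.
have deg_v : w0 < deg v.
  rewrite /deg (bigD1 x) //= ltrDl (bigD1 y) ?vy 1?eq_sym //=.
  rewrite ltr_wpDr ?adj_weight_gt0 // sumr_ge0 // => w /andP[/andP[vw _] _].
  exact/ltW/adj_weight_gt0.
have w0_gt0 : 0 < w0 by exact: adj_weight_gt0.
have sx_ge0 : 0 <= side_deg evx x by apply: sumr_ge0 => t _; exact: deg_ge0.
move: yz_le S0 deg_v w0_gt0 sx_ge0; rewrite -/evy.
move: (side_deg evx x) (side_deg evy y) (side_deg _ z) S w0 (deg v) (total_deg G).
move=> sx sy sz r w d t yz_sz r0 wd w_gt0 sx0 tE.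
have /mulr_gt0 : 0 < w + sx by lra.
(* By [sum_branches], t is deg v plus all branches, so the left-over is (sz - sy) + r + (deg v - w);
   the last part is positive because v has other neighbours than x. *)
have p2 : 0 < t - 2 * sy - (w + sx) by lra.
move=> /(_ _ p2); nra.
Qed.

End Exchange.

(** * Extremal trees *)

Lemma maximizes_kemeny_path (R : realType) (W : {mset R}) (T : wgraph R) :
  maximizes_kemeny W T -> is_path T.
Proof.
move=> [[treeT TW] maxT]; apply: degree_le2_path => // v x y z vx vy vz xy xz yz.
have max_exchange a b (va : adj v a) (vb : adj v b) (ab : a != b) c (vc : adj v c) :
    a != c -> b != c -> side_deg [set v; b]%SET b <= side_deg [set v; c]%SET c -> False.
  move=> ac bc le_bc.
  have := exchange_kemeny treeT va vb vc ab ac bc le_bc.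
  apply/negP; rewrite -leNgt; apply: maxT; split; first exact: exchange_tree.
  by rewrite exchange_edge_weights.
(* The roles of y and z are interchangeable: x is attached to whichever of them carries the branch
   that is not heavier. *)
have [le_yz|/ltW le_zy] := leP (side_deg [set v; y]%SET y) (side_deg [set v; z]%SET z).
  exact: (max_exchange x y vx vy xy z vz xz yz le_yz).
by apply: (max_exchange x z vx vz xz y vy xy _ le_zy); rewrite eq_sym.
Qed.

(** For nonempty [W] with positive entries this is |W| - 1/2; the unsimplified sum matches the
    edgewise bound term by term. *)
Definition star_bound (R : realType) (W : {mset R}) : R :=
  let t := 2 * \sum_(x <- enum_mset W) x in (\sum_(x <- enum_mset W) (t - x)) / t.

Lemma star_boundE (R : realType) (W : {mset R}) (T : wgraph R) : edge_weights T = W ->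
  (\sum_(e in edges T) (total_deg T - weight e)) / total_deg T = star_bound W.
Proof.
move=> TW; rewrite /star_bound total_deg_edges (edge_weights_sum id TW).
by rewrite (edge_weights_sum (fun x => _ - x) TW).
Qed.

Theorem theorem3 (R : realType) (W : {mset R}) (W_neq0 : W <> mset0)
    (W_gt0 : forall x : R, x \in W -> 0 < x) :
  (forall T : wgraph R, maximizes_kemeny W T -> is_path T) /\
  minimizes_kemeny W (star_graph W_gt0) /\
  (forall T : wgraph R, minimizes_kemeny W T ->
     weighted_iso T (star_graph W_gt0)).
Proof.
have starTW := star_graph_TW W_gt0.
have kemeny_star : kemeny (star_graph W_gt0) = (star_bound W)%:E.
  have [treeS SW] := starTW.
  rewrite star_kemeny //; last exact: star_graph_star.
    by rewrite (star_boundE SW).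
  exact: in_TW_edges_neq0 starTW.
have star_min T : in_TW W T -> (kemeny (star_graph W_gt0) <= kemeny T)%E.
  move=> TTW; have [treeT TW] := TTW.
  rewrite kemeny_star -(star_boundE TW).
  exact/(kemeny_ge treeT)/(in_TW_edges_neq0 W_neq0 TTW).
split; first exact: maximizes_kemeny_path.
split=> [//|T [TTW minT]]; apply: star_graph_unique => //.
have [treeT TW] := TTW; have edgeT := in_TW_edges_neq0 W_neq0 TTW.
apply: leaf_edges_star => // x y; apply: kemeny_minimal_leaf_edges => //.
rewrite (star_boundE TW) -kemeny_star; apply/eqP; rewrite eq_le star_min // andbT.
exact: minT.
Qed.
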